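(* For every integer $n \geq 1$, the weak order $W_n$ on the symmetric group $S_n$ is strongly Sperner, and therefore Peck.
   Context: A finite ranked poset $P$ with rank decomposition $P = P_0 \sqcup \cdots \sqcup P_r$ is called $k$-Sperner if no union of $k$ antichains of $P$ has more elements than the union of the $k$ largest ranks $P_i$. It is strongly Sperner if it is $k$-Sperner for every $k = 1, \ldots, r$. Writing $p_i = |P_i|$, $P$ is rank symmetric if $p_i = p_{r-i}$ for all $i$, rank unimodal if $p_0 \leq \cdots \leq p_j \geq p_{j+1} \geq \cdots \geq p_r$ for some $j$, and Peck if it is rank symmetric, rank unimodal and strongly Sperner. $S_n$ is the symmetric group on $\{1,\ldots,n\}$, with permutations written in one-line notation $w = w_1 w_2 \cdots w_n$. For $1 \le i \le n-1$, $s_i = (i\ i+1)$ is a simple transposition, and $ws_i$ is the permutation obtained from $w$ by swapping the entries in positions $i$ and $i+1$. The length $\ell(w)$ is the number of inversions of $w$, i.e. the number of pairs $i<j$ with $w_i > w_j$. The weak order $W_n = (S_n, \leq)$ is the partial order on $S_n$ whose cover relations are exactly $u \lessdot w$ when $w = us_i$ for some $i$ and $\ell(w) = \ell(u)+1$. It is ranked by $\ell$, with maximum rank $\binom{n}{2}$. *)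

(* Defs.v *)
From HB Require Import structures.
From mathcomp Require Import all_boot all_order all_fingroup.

Set Implicit Arguments.
Unset Strict Implicit.
Unset Printing Implicit Defensive.

Import Order.Theory.

Definition covers (d : Order.disp_t) (P : porderType d) (x y : P) : Prop :=
  (x < y)%O /\ forall z : P, ~~ ((x < z)%O && (z < y)%O).

Record rankedPoset (d : Order.disp_t) := RankedPoset {
  rp_sort :> finPOrderType d;
  rank : rp_sort -> nat;
  toprank : nat;
  rank_leq : forall x, rank x <= toprank;
  rank_covers : forall x y, covers x y -> rank y = (rank x).+1
}.

Section Peck.
Variables (d : Order.disp_t) (P : rankedPoset d).

Definition level (i : nat) : {set P} := [set x | rank x == i].

Definition antichain (A : {set P}) : Prop :=
  {in A &, forall x y, (x <= y)%O -> x = y}.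

(* Ties between ranks of equal size are broken arbitrarily, which does not
   affect the size of the union of the levels. *)
Definition largest_ranks (k : nat) : seq nat :=
  take k (sort (fun i j => #|level j| <= #|level i|) (iota 0 (toprank P).+1)).

Definition k_sperner (k : nat) : Prop :=
  forall A : 'I_k -> {set P}, (forall i, antichain (A i)) ->
    #|\bigcup_(i < k) A i| <= #|\bigcup_(i <- largest_ranks k) level i|.

Definition strongly_sperner : Prop :=
  forall k, 1 <= k <= toprank P -> k_sperner k.

Definition rank_symmetric : Prop :=
  forall i, i <= toprank P -> #|level i| = #|level (toprank P - i)|.

Definition rank_unimodal : Prop :=
  exists2 j, j <= toprank P &
    (forall i, i < j -> #|level i| <= #|level i.+1|) /\
    (forall i, j <= i < toprank P -> #|level i.+1| <= #|level i|).

Definition peck : Prop :=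
  [/\ rank_symmetric, rank_unimodal & strongly_sperner].

End Peck.

Definition perm_length (n : nat) (w : 'S_n) : nat :=
  #|[set p : 'I_n * 'I_n | (p.1 < p.2) && (w p.2 < w p.1)]|.

(* Permutation products compose left to right here, (s * t) x = t (s x), so
   tperm i j * u is the permutation written u s_i when products compose right
   to left: it swaps the entries of u in positions i and j = i + 1. *)
Definition weak_cover (n : nat) (u w : 'S_n) : bool :=
  [exists i : 'I_n, exists j : 'I_n,
     (j == i.+1 :> nat) && (w == (tperm i j * u)%g)]
  && (perm_length w == (perm_length u).+1).

Definition weak_perm (n : nat) : Type := 'S_n.
HB.instance Definition _ n := Finite.on (weak_perm n).

Section WeakOrder.
Variable n : nat.
Implicit Types u v w : weak_perm n.

Definition weak_le u w : bool := connect (@weak_cover n) u w.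

Lemma weak_le_length u w :
  weak_le u w -> u = w \/ perm_length u < perm_length w.
Proof.
case/connectP=> p; elim: p u => [|v p IHp] u /=; first by move=> _ ->; left.
case/andP=> /andP[_ /eqP lv] pth def_w; right.
by case: (IHp v pth def_w) => [<-|]; [rewrite lv | apply: ltn_trans; rewrite lv].
Qed.

Lemma weak_le_refl : reflexive weak_le.
Proof. by move=> u; apply: connect0. Qed.

Lemma weak_le_anti : antisymmetric weak_le.
Proof.
move=> u w /andP[/weak_le_length[//|lt_uw] /weak_le_length[//|lt_wu]].
by move: (ltn_trans lt_uw lt_wu); rewrite ltnn.
Qed.

Lemma weak_le_trans : transitive weak_le.
Proof. by move=> v u w; apply: connect_trans. Qed.

End WeakOrder.

Fact weak_display : Order.disp_t. Proof. exact: (Order.Disp tt tt). Qed.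

HB.instance Definition _ n := Order.Le_isPOrder.Build weak_display (weak_perm n)
  (@weak_le_refl n) (@weak_le_anti n) (@weak_le_trans n).

Section WeakRanked.
Variable n : nat.
Implicit Types u v w : weak_perm n.

Lemma weak_lt_length u w : (u < w)%O -> perm_length u < perm_length w.
Proof.
rewrite lt_neqAle => /andP[/eqP neq_uw le_uw].
by case: (@weak_le_length n u w le_uw).
Qed.

Lemma weak_cover_lt u w : weak_cover u w -> (u < w)%O.
Proof.
move=> uw; rewrite lt_neqAle; apply/andP; split; last exact: connect1.
apply/eqP=> def_w; case/andP: uw => _; rewrite def_w => /eqP lw.
exact: (n_Sn _ lw).
Qed.

Lemma weak_coversP u w : covers u w <-> weak_cover u w.
Proof.
split=> [[lt_uw no_mid]|uw].
  have: weak_le u w by apply: ltW.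
  case/connectP=> [[|v p] /=].
    by move=> _ def_w; rewrite def_w ltxx in lt_uw.
  case/andP=> uv pth def_w; have lt_uv := weak_cover_lt uv.
  have le_vw : (v <= w :> weak_perm n)%O by apply/connectP; exists p.
  move: (no_mid v); rewrite lt_uv /= lt_neqAle le_vw andbT negbK.
  by move/eqP<-.
split=> [|z]; first exact: weak_cover_lt.
apply/andP=> [[/weak_lt_length lt_uz /weak_lt_length]].
by case/andP: uw => _ /eqP->; rewrite ltnS leqNgt lt_uz.
Qed.

Lemma perm_length_le w : perm_length w <= 'C(n, 2).
Proof.
have -> : 'C(n, 2) = #|[set p : 'I_n * 'I_n | p.1 < p.2]|.
  rewrite -bin2_sum big_mkord -sum1dep_card.
  rewrite -(pair_big_dep xpredT (fun i j : 'I_n => i < j) (fun _ _ => 1)) /=.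
  rewrite (exchange_big_dep xpredT) //=; apply: eq_bigr => j _.
  rewrite sum1dep_card -[LHS]card_ord.
  have widen_inj : injective (widen_ord (ltnW (ltn_ord j))).
    by move=> a b /(congr1 val) /= /val_inj.
  rewrite -(card_imset _ widen_inj).
  apply: eq_card => i; rewrite !inE; apply/imsetP/idP => [[k _ ->]|lt_ij] //=.
  by exists (Ordinal lt_ij) => //; apply: val_inj.
by apply/subset_leq_card/subsetP=> p; rewrite !inE => /andP[].
Qed.

Lemma weak_covers_length u w :
  covers u w -> perm_length w = (perm_length u).+1.
Proof. by case/weak_coversP/andP=> _ /eqP. Qed.

End WeakRanked.

Definition weak_order (n : nat) : rankedPoset weak_display :=
  RankedPoset (@perm_length_le n) (@weak_covers_length n).

(* Main.v *)
(** The span of the monomials [x^a] with [a_j <= j], [1 <= j < n], is a tensor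
product of irreducible sl2-modules, and the generating function of the Schubert
polynomials maps its dual onto the space with basis S_n.  Under this map the
raising operator of the tensor product becomes the raising operator of the weak
order that multiplies the cover [u < u s_j] by a positive integer depending only
on [j].  Hence a power of this weighted raising operator maps rank [k] onto rank
[r - k], where [r] is the top rank, whenever [2 k <= r].  Expanding the
determinant of that power yields [p_k] disjoint saturated chains from rank [k]
to rank [r - k]; chains through the [q] middle ranks, prolonged to the outer
ranks, bound the size of a union of [q] antichains. *)

Require Import Defs.
From HB Require Import structures.
From mathcomp Require Import all_boot all_order all_fingroup all_algebra.
From mathcomp Require Import zify.

Set Implicit Arguments.
Unset Strict Implicit.
Unset Printing Implicit Defensive.

Import Order.TTheory GRing.Theory Num.Theory.
Local Open Scope ring_scope.

(** * NilCoxeter relations *)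

Section NilCoxeter.
Variables (R : pzRingType) (v : nat -> R).
Hypothesis v_sq : forall j, v j * v j = 0.
Hypothesis v_comm : forall i j, (i.+1 < j)%N -> v i * v j = v j * v i.
Hypothesis v_braid : forall j, v j * v j.+1 * v j = v j.+1 * v j * v j.+1.

(* The coefficient of [x^a] in [(1 + x v_(m-1)) ... (1 + x v_0)]. *)
Fixpoint nesym (m a : nat) : R :=
  match m, a with
  | _, 0 => 1
  | 0, _.+1 => 0
  | m'.+1, a'.+1 => nesym m' a'.+1 + v m' * nesym m' a'
  end.

Definition vsum m := \sum_(j < m) v j.
(** These weights make [wsum m] the sum of [vsum 1], ..., [vsum m], which is the form the induction
    for [nesym_wsum] consumes. *)
Definition wsum m := \sum_(j < m) v j *+ (m - j).

Lemma nesym0 m : nesym m 0 = 1. Proof. by case: m. Qed.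

Lemma nesymSS m a : nesym m.+1 a.+1 = nesym m a.+1 + v m * nesym m a.
Proof. by []. Qed.

Lemma nesym_big m a : (m < a)%N -> nesym m a = 0.
Proof.
elim: m a => [|m IHm] [|a] //= lt_ma.
by rewrite !IHm ?mulr0 ?addr0 // ltnW.
Qed.

Lemma vsumS m : vsum m.+1 = vsum m + v m.
Proof. by rewrite /vsum big_ord_recr. Qed.

Lemma wsumS m : wsum m.+1 = wsum m + vsum m.+1.
Proof.
rewrite /wsum /vsum !big_ord_recr /= subSnn addrA -big_split /=.
by congr (_ + _); apply: eq_bigr => j _; rewrite subSn 1?ltnW // mulrS addrC.
Qed.

Lemma nesym_comm m a j : (m < j)%N -> nesym m a * v j = v j * nesym m a.
Proof.
elim: m a => [|m IHm] [|a] /= lt_mj; rewrite ?mulr1 ?mul1r ?mulr0 ?mul0r //.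
rewrite mulrDl mulrDr !IHm 1?ltnW // -mulrA IHm 1?ltnW // !mulrA.
by rewrite v_comm.
Qed.

Lemma vsum_comm m j : (m < j)%N -> vsum m * v j = v j * vsum m.
Proof.
move=> lt_mj; rewrite /vsum big_distrl big_distrr /=; apply: eq_bigr => i _.
by apply: v_comm; have := ltn_ord i; lia.
Qed.

Lemma wsum_comm m j : (m < j)%N -> wsum m * v j = v j * wsum m.
Proof.
move=> lt_mj; rewrite /wsum big_distrl big_distrr /=; apply: eq_bigr => i _.
by rewrite mulrnAl mulrnAr v_comm //; have := ltn_ord i; lia.
Qed.

Lemma vsum_commutator m :
  v m.+1 * vsum m.+1 = vsum m.+1 * v m.+1 + v m.+1 * v m - v m * v m.+1.
Proof.
by rewrite vsumS mulrDl mulrDr vsum_comm // [RHS]addrAC addrK.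
Qed.

(** The correction needed in the inductive step of [vsum_nesym_comm]. After splitting off the letter
    [v m], the surplus words contain a square or cancel in pairs, once through the braid
    relation. *)
Lemma nesym_v_rel m a :
  (v m.+1 * v m - v m * v m.+1) * nesym m.+1 a + nesym m.+1 a.+1 * v m.+1
    + v m.+1 * nesym m.+1 a * v m.+1 = v m.+1 * nesym m.+1 a.+1.
Proof.
case: a => [|a].
  rewrite /= !nesym0 !mulr1 v_sq addr0 mulrDl mulrDr nesym_comm //.
  by rewrite addrCA subrK.
rewrite !nesymSS.
have E0 := nesym_comm a (ltnSn m); have E1 := nesym_comm a.+1 (ltnSn m).
have E2 := nesym_comm a.+2 (ltnSn m); have br := v_braid m.
have bb := v_sq m; have cc := v_sq m.+1.
move: (nesym m a) (nesym m a.+1) (nesym m a.+2) E0 E1 E2 => e0 e1 e2 E0 E1 E2.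
move: (v m) (v m.+1) br bb cc E0 E1 E2 => b c br bb cc E0 E1 E2.
have -> : (c * b - b * c) * (e1 + b * e0)
    = c * b * e1 - b * c * e1 - b * c * b * e0.
  rewrite mulrBl !mulrDr !mulrA -(mulrA c b b) bb mulr0 mul0r addr0.
  by rewrite opprD addrA.
have -> : (e2 + b * e1) * c = c * e2 + b * c * e1.
  by rewrite mulrDl E2 -mulrA E1 mulrA.
have -> : c * (e1 + b * e0) * c = b * c * b * e0.
  by rewrite -mulrA mulrDl E1 mulrDr mulrA cc mul0r add0r -mulrA E0 !mulrA br.
by rewrite addrAC subrK addrC addrCA addrK addrC mulrDr mulrA.
Qed.

(** Since [vsum m] is [nesym m 1], this is an instance of the commutativity of noncommutative
    elementary symmetric functions. In the induction, [vsum m.+1] fails to commute with [v m.+1]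
    only through [v m], and [nesym_v_rel] absorbs that defect. *)
Lemma vsum_nesym_comm m a : nesym m a * vsum m = vsum m * nesym m a.
Proof.
case: m a; first by move=> a; rewrite /vsum big_ord0 mul0r mulr0.
elim=> [|m IHm] [|a]; rewrite ?nesym0 ?mulr1 ?mul1r //.
  rewrite /vsum big_ord1 /=.
  by case: a => [|a]; rewrite /= add0r ?mulr1 // mulr0 mulr0 mul0r.
rewrite nesymSS vsumS; move: (IHm a.+1) (IHm a) (nesym_v_rel m a).
move: (vsum_commutator m) (v_sq m.+1); move: (nesym m.+1 a.+1) (nesym m.+1 a).
move: (vsum _) (v m) (v m.+1) => T b c x y cT cc xT yT rel.
have -> : (T + c) * (x + c * y) = T * x + T * c * y + c * x.
  by rewrite mulrDl !mulrDr !mulrA cc mul0r addr0.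
have -> : (x + c * y) * (T + c) = T * x + c * T * y + x * c + c * y * c.
  by rewrite mulrDr !mulrDl xT -(mulrA c y T) yT -!addrA mulrA.
rewrite cT -rel -(addrA (T * c)) (mulrDl (T * c)) !addrA.
by congr (_ + _ + _).
Qed.

(* The generating-function form, with [B_m(x) = sum_a (nesym m a) x^a], is
   [B_m wsum_m = B_m' + wsum_(m-1) B_m]. *)
Lemma nesym_wsum m a :
  nesym m a * wsum m = nesym m a.+1 *+ a.+1 + wsum m.-1 * nesym m a.
Proof.
elim: m a => [|m IHm] a.
  by rewrite /wsum big_ord0 mulr0 mul0r mul0rn addr0.
have wsumE : wsum m = wsum m.-1 + vsum m.
  by case: (m) => [|k]; rewrite ?wsumS // /wsum /vsum !big_ord0 addr0.
have w_comm : wsum m.-1 * v m = v m * wsum m.-1.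
  case: (m) => [|k]; last exact: wsum_comm.
  by rewrite /wsum big_ord0 mul0r mulr0.
have v_nesym b : v m * nesym m.+1 b = v m * nesym m b.
  case: b => [|b]; rewrite ?nesym0 // nesymSS mulrDr mulrA v_sq mul0r.
  by rewrite addr0.
(* In [wsum m.+1 = wsum m + vsum m.+1] the second summand commutes with [nesym]; the first is
   expanded by induction. *)
rewrite wsumS mulrDr vsum_nesym_comm vsumS mulrDl v_nesym succnK.
case: a => [|a].
  have := IHm 0%N; rewrite nesymSS !nesym0 !mul1r !mulr1 !mulr1n => w0.
  by rewrite [in RHS]wsumE w0 (addrC (vsum m)) addrACA.
have -> : nesym m.+1 a.+1 * wsum m = nesym m a.+2 *+ a.+2
    + v m * nesym m a.+1 *+ a.+1 + wsum m.-1 * nesym m.+1 a.+1.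
  rewrite nesymSS mulrDl IHm -mulrA IHm (mulrDr (v m)) mulrA -w_comm.
  by rewrite (mulrDr (wsum _)) (mulrA (wsum _)) addrACA mulrnAr.
rewrite [in RHS]wsumE (mulrDl (wsum m.-1)) (nesymSS m a.+1).
rewrite (mulrnDl _ (nesym m _)) (mulrSr (v m * _) a.+1) !addrA.
by rewrite [LHS](ACl (1 * 2 * 5 * 3 * 4)).
Qed.

(* [v_(m-1) ... v_(m-b)], the leading term of [nesym m b] when [b <= m]. *)
Fixpoint crun (m b : nat) : R :=
  match m, b with
  | m'.+1, b'.+1 => v m' * crun m' b'
  | _, _ => 1
  end.

Lemma crun0 m : crun m 0 = 1. Proof. by case: m. Qed.

Lemma crunSS m b : crun m.+1 b.+1 = v m * crun m b. Proof. by []. Qed.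

Lemma crun_comm m b j : (m < j)%N -> crun m b * v j = v j * crun m b.
Proof.
elim: m b => [|m IHm] [|b] lt_mj; rewrite ?mulr1 ?mul1r //.
by rewrite crunSS -mulrA IHm 1?ltnW // !mulrA v_comm.
Qed.

(** A letter below the run commutes to the front or extends the run; a letter equal to the last one
    squares to zero; a higher one passes to the front by a braid move that lowers its index by one.
    The bound on [i] keeps the new front letter among the generators of the smaller algebra. *)
Lemma crun_mul_v m b j : (b <= m)%N -> (j < m)%N ->
  [\/ crun m b * v j = 0,
      (b < m)%N /\ crun m b * v j = crun m b.+1 |
      exists2 i, (i.+1 < m)%N & crun m b * v j = v i * crun m b].
Proof.
elim: m b j => [|m IHm] [|b] // j; rewrite ?crun0 ?mul1r ltnS => le_bm.
  rewrite leq_eqVlt => /predU1P[->|lt_jm].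
    by apply: Or32; split=> //; rewrite crunSS crun0 mulr1.
  by apply: Or33; exists j; rewrite // mulr1.
rewrite ltnS leq_eqVlt => /predU1P[->|lt_jm]; last first.
  rewrite crunSS -mulrA.
  case: (IHm b j le_bm lt_jm) => [->|[lt_bm ->]|[i lt_im ->]].
  - by apply: Or31; rewrite mulr0.
  - by apply: Or32.
  - apply: Or33; exists i; first exact: ltnW.
    by rewrite !mulrA -v_comm.
case: m b {IHm} le_bm => [|m] [|b] // le_bm.
- by apply: Or31; rewrite crunSS crun0 mulr1 v_sq.
- by apply: Or31; rewrite crunSS crun0 mulr1 v_sq.
- apply: Or33; exists m => //; rewrite !crunSS -!mulrA crun_comm //.
  by rewrite !mulrA v_braid.
Qed.

(** * Homogeneous words and their normal form *)

Inductive wordspan (m : nat) : nat -> R -> Prop :=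
| Wordspan1 : wordspan m 0 1
| WordspanMv d x j : wordspan m d x -> (j < m)%N -> wordspan m d.+1 (x * v j)
| Wordspan0 d : wordspan m d 0
| WordspanD d x y : wordspan m d x -> wordspan m d y -> wordspan m d (x + y).

Lemma wordspanM m d1 d2 x y :
  wordspan m d1 x -> wordspan m d2 y -> wordspan m (d1 + d2) (x * y).
Proof.
move=> Wx; elim=> {d2 y} [|d y j _ IH lt_jm|d|d y z _ IHy _ IHz].
- by rewrite addn0 mulr1.
- by rewrite addnS mulrA; apply: WordspanMv.
- by rewrite mulr0; apply: Wordspan0.
- by rewrite mulrDr; apply: WordspanD.
Qed.

Lemma wordspan_widen m1 m2 d x :
  (m1 <= m2)%N -> wordspan m1 d x -> wordspan m2 d x.
Proof.
move=> le_m; elim=> {d x} [|d x j _ IH lt_jm|d|d x y _ IHx _ IHy].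
- exact: Wordspan1.
- by apply: WordspanMv => //; apply: leq_trans le_m.
- exact: Wordspan0.
- exact: WordspanD.
Qed.

Lemma wordspan_v m j : (j < m)%N -> wordspan m 1 (v j).
Proof.
by move=> lt_jm; rewrite -[v j]mul1r; apply/WordspanMv/lt_jm/Wordspan1.
Qed.

Lemma wordspan_comm m d x j :
  (m < j)%N -> wordspan m d x -> x * v j = v j * x.
Proof.
move=> lt_mj; elim=> {d x} [|d x i _ IH lt_im|d|d x y _ IHx _ IHy].
- by rewrite mul1r mulr1.
- by rewrite -mulrA v_comm ?(leq_ltn_trans lt_im) // !mulrA IH.
- by rewrite mul0r mulr0.
- by rewrite mulrDl mulrDr IHx IHy.
Qed.

Lemma wordspan_nesym m a : wordspan m a (nesym m a).
Proof.
elim: m a => [|m IHm] [|a]; rewrite ?nesym0; try exact: Wordspan1.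
  exact: Wordspan0.
rewrite nesymSS; apply: WordspanD; first exact: wordspan_widen (IHm _).
rewrite -[a.+1]add1n; apply: wordspanM; first exact: wordspan_v.
exact: wordspan_widen (IHm _).
Qed.

(** This mirrors the coset decomposition of S_(m+2) over S_(m+1): a word in smaller letters followed
    by a descending run from [v m]. The strict bound [a] on the run length serves as the measure for
    triangularity arguments. *)
Inductive runspan (m a : nat) : nat -> R -> Prop :=
| RunspanMc d b x : (b < a)%N -> (b <= m.+1)%N -> wordspan m d x ->
    runspan m a (d + b) (x * crun m.+1 b)
| Runspan0 d : runspan m a d 0
| RunspanD d x y : runspan m a d x -> runspan m a d y -> runspan m a d (x + y).

Lemma runspan_mulv m a d x : runspan m a d x ->
  runspan m.+1 a.+1 d.+1 (v m.+1 * x).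
Proof.
elim=> {d x} [d b x lt_ba le_bm Wx|d|d x y _ IHx _ IHy].
- rewrite mulrA -(wordspan_comm _ Wx) // -mulrA -crunSS -addnS.
  by apply: RunspanMc => //; apply: wordspan_widen Wx.
- by rewrite mulr0; apply: Runspan0.
- by rewrite mulrDr; apply: RunspanD.
Qed.

(** Unitriangularity between [nesym] and runs. In the recursion the summand without the top letter
    is a word with empty run, and the other summand lengthens every run by one. *)
Lemma nesym_crun m a : (a <= m.+1)%N ->
  exists2 t, runspan m a a t & nesym m.+1 a = crun m.+1 a + t.
Proof.
elim: m a => [|m IHm] [|a] le_am.
- by exists 0; [apply: Runspan0 | rewrite addr0].
- exists 0; first exact: Runspan0.
  by case: a le_am => //; rewrite /= addr0 add0r.
- by exists 0; [apply: Runspan0 | rewrite addr0].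
have [t Rt et] := IHm a le_am.
exists (v m.+1 * t + nesym m.+1 a.+1 * crun m.+2 0).
  apply: RunspanD; first exact: runspan_mulv.
  rewrite -[X in runspan _ _ X]addn0.
  by apply: RunspanMc => //; apply: wordspan_nesym.
rewrite nesymSS et mulrDr crunSS crun0 mulr1.
by rewrite addrC -[LHS]addrA.
Qed.

(** Letters are appended one at a time; by [crun_mul_v] each kills the term, lengthens the run, or
    joins the word before it. *)
Lemma wordspan_runspan m d x : wordspan m.+1 d x -> runspan m m.+2 d x.
Proof.
elim=> {d x} [|d x j _ IH lt_jm|d|d x y _ IHx _ IHy]; last 2 first.
- exact: Runspan0.
- exact: RunspanD.
- rewrite -[1]mulr1 -(crun0 m.+1) -[X in runspan _ _ X]addn0.
  by apply: RunspanMc => //; apply: Wordspan1.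
elim: IH => {d x} [d b x _ le_bm Wx|d|d x y _ IHx _ IHy]; last 2 first.
- by rewrite mul0r; apply: Runspan0.
- by rewrite mulrDl; apply: RunspanD.
rewrite -mulrA; case: (crun_mul_v le_bm lt_jm) => [->|[lt_bm ->]|[i lt_im ->]].
- by rewrite mulr0; apply: Runspan0.
- by rewrite -addnS; apply: RunspanMc => //; rewrite ltnS.
- by rewrite mulrA -addSn; apply: RunspanMc => //; apply: WordspanMv.
Qed.

End NilCoxeter.
Arguments nesym : simpl never.

(** * The sl2 argument *)

Section SL2.
Variables (V : lmodType rat) (X Y D : {linear V -> V}) (r : nat).
Hypothesis DX : forall u, D (X u) = X (D u) + X u.
Hypothesis DY : forall u, D (Y u) = Y (D u) - Y u.
Hypothesis XY : forall u, X (Y u) = Y (X u) + D u *+ 2 - u *+ r.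
Hypothesis D_bound : forall d u, (r < d)%N -> D u = u *+ d -> u = 0.

Lemma iter_linearMn (F : {linear V -> V}) n u k :
  iter n F (u *+ k) = iter n F u *+ k.
Proof. by elim: n => //= n ->; rewrite raddfMn. Qed.

Lemma iter_linearD (F : {linear V -> V}) n : {morph iter n F : u w / u + w}.
Proof. by elim: n => // n IHn u w /=; rewrite IHn linearD. Qed.

Lemma iter_linearZ (F : {linear V -> V}) n c u :
  iter n F (c *: u) = c *: iter n F u.
Proof. by elim: n => //= n ->; rewrite linearZ. Qed.

Lemma D_iterX n d u : D u = u *+ d -> D (iter n X u) = iter n X u *+ (d + n).
Proof.
move=> Du; elim: n => [|n IHn] /=; first by rewrite addn0.
by rewrite DX IHn raddfMn addnS mulrSr.
Qed.

Lemma D_iterY n d u : D u = u *+ (d + n) -> D (iter n Y u) = iter n Y u *+ d.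
Proof.
elim: n d => [|n IHn] d /=; first by rewrite addn0.
rewrite addnS -addSn => /IHn Du.
by rewrite DY Du raddfMn mulrSr addrK.
Qed.

(** The sl2 string formula for a highest weight vector [u] of weight [m = 2d - r], the commutator of
    [X] and [Y] being [2D - r]. *)
Lemma X_iterY m j d u : (m <= d)%N -> (r + m = d + d)%N -> (j <= m)%N ->
  D u = u *+ d -> X u = 0 ->
  X (iter j.+1 Y u) = iter j Y u *+ (j.+1 * (m - j)).
Proof.
move=> le_md rm + Du Xu; elim: j => [_|j IHj lt_jm] /=.
  rewrite XY Xu raddf0 add0r Du -mulrnA mul1n subn0.
  by rewrite -mulrnBr; [congr (_ *+ _); lia|lia].
rewrite XY IHj 1?ltnW // raddfMn.
have -> : D (Y (iter j Y u)) = iter j.+1 Y u *+ (d - j.+1).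
  by apply: (D_iterY (n := j.+1)); rewrite Du; congr (_ *+ _); lia.
rewrite /= -mulrnA -mulrnDr -mulrnBr; first by congr (_ *+ _); nia.
nia.
Qed.

Lemma iterX_iterY m j d u : (m <= d)%N -> (r + m = d + d)%N -> (j <= m)%N ->
  D u = u *+ d -> X u = 0 ->
  exists2 c : nat, (0 < c)%N & iter j X (iter j Y u) = u *+ c.
Proof.
move=> le_md rm + Du Xu; elim: j => [_|j IHj lt_jm]; first by exists 1%N.
have [c c_gt0 IH] := IHj (ltnW lt_jm).
exists (c * (j.+1 * (m - j)))%N; first by rewrite !muln_gt0 c_gt0 subn_gt0.
by rewrite iterSr (X_iterY le_md) 1?ltnW // iter_linearMn IH -mulrnA.
Qed.

(* Downward induction on the degree of [u]: subtracting an element of the image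
   makes [u] a highest weight vector, on which [X^m Y^m] is a nonzero scalar. *)
Lemma iterX_onto k u : (2 * k <= r)%N -> D u = u *+ (r - k) ->
  exists2 w, D w = w *+ k & u = iter (r - 2 * k) X w.
Proof.
elim: k u => [|k IHk] u le_kr Du.
  (* In the base case [X u] would have degree [r + 1]. *)
  have Xu : X u = 0.
    by apply: (D_bound (ltnSn r)); rewrite DX Du raddfMn subn0 mulrSr.
  rewrite subn0 in Du.
  have [c c_gt0 XYu] := iterX_iterY (leqnn r) erefl (leqnn r) Du Xu.
  have Dy : D (iter r Y u) = iter r Y u *+ 0 by apply: D_iterY.
  exists (c%:R^-1 *: iter r Y u).
    by rewrite linearZ /= Dy !mulr0n scaler0.
  rewrite muln0 subn0 iter_linearZ XYu -scaler_nat scalerA mulVf ?scale1r //.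
  by rewrite pnatr_eq0 -lt0n.
have DXu : D (X u) = X u *+ (r - k).
  by rewrite DX Du raddfMn -mulrSr; congr (_ *+ _); lia.
have le_kr' : (2 * k <= r)%N by lia.
have [w Dw Xu] := IHk (X u) le_kr' DXu.
set m := (r - 2 * k.+1)%N.
have em : (r - 2 * k = m.+2)%N by lia.
rewrite em in Xu.
(* By induction [X u = X^(m+2) w], so this difference is killed by [X]. *)
pose u' := u - iter m.+1 X w.
have Xu' : X u' = 0 by rewrite /u' linearB /= Xu subrr.
have Du' : D u' = u' *+ (r - k.+1).
  rewrite /u' linearB /= Du (DX (iter m X w)) (D_iterX _ Dw) raddfMn.
  rewrite -mulrSr mulrnBl.
  by congr (_ - _ *+ _); lia.
have le_md : (m <= r - k.+1)%N by lia.
have rm : (r + m = (r - k.+1) + (r - k.+1))%N by lia.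
have [c c_gt0 XYu] := iterX_iterY le_md rm (leqnn m) Du' Xu'.
exists (c%:R^-1 *: iter m Y u' + X w).
  rewrite linearD linearZ /= DX Dw raddfMn (@D_iterY m k.+1 u'); last first.
    by rewrite Du'; congr (_ *+ _); lia.
  by rewrite mulrnDl -mulrSr -scalerMnr.
rewrite iter_linearD iter_linearZ XYu -scaler_nat scalerA mulVf ?scale1r.
  by rewrite -iterSr /u' subrK.
by rewrite pnatr_eq0 -lt0n.
Qed.
End SL2.

(** * The tensor product of chains and its image *)

(* Functions on the exponents [a] with [a_j <= j], [1 <= j <= m]. *)
Fixpoint box (m : nat) : lmodType rat :=
  if m is m'.+1 then {ffun 'I_m'.+2 -> box m'} else rat^o.

(** Each coordinate carries an irreducible sl2-module, and [boxX], [boxY], [boxD] act on the tensor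
    product by the Leibniz rule. Where [a.-1] or [a.+1] leaves the range, the coefficient is zero,
    so the value of [inord] there is harmless. *)
Fixpoint boxX m : box m -> box m :=
  match m return box m -> box m with
  | 0 => fun _ => 0
  | m'.+1 => fun F => [ffun a : 'I_m'.+2 => boxX (F a) + F (inord a.-1) *+ a]
  end.

Fixpoint boxY m : box m -> box m :=
  match m return box m -> box m with
  | 0 => fun _ => 0
  | m'.+1 => fun F =>
      [ffun a : 'I_m'.+2 => boxY (F a) + F (inord a.+1) *+ (m'.+1 - a)]
  end.

Fixpoint boxD m : box m -> box m :=
  match m return box m -> box m with
  | 0 => fun _ => 0
  | m'.+1 => fun F => [ffun a : 'I_m'.+2 => boxD (F a) + F a *+ a]
  end.

Lemma box_addE m (F G : box m.+1) a : (F + G) a = F a + G a.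
Proof. exact: ffunE. Qed.

Lemma box_oppE m (F : box m.+1) a : (- F) a = - F a.
Proof. exact: ffunE. Qed.

Lemma box_scaleE m c (F : box m.+1) a : (c *: F) a = c *: F a.
Proof. exact: ffunE. Qed.

Lemma boxXE m (F : box m.+1) a : boxX F a = boxX (F a) + F (inord a.-1) *+ a.
Proof. by rewrite ffunE. Qed.
Lemma boxYE m (F : box m.+1) a :
  boxY F a = boxY (F a) + F (inord a.+1) *+ (m.+1 - a).
Proof. by rewrite ffunE. Qed.
Lemma boxDE m (F : box m.+1) a : boxD F a = boxD (F a) + F a *+ a.
Proof. by rewrite ffunE. Qed.

Lemma box_mulnE m (F : box m.+1) n a : (F *+ n) a = F a *+ n.
Proof. by rewrite -!scaler_nat box_scaleE. Qed.

Lemma boxX_linear m : linear (@boxX m).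
Proof.
elim: m => [|m IHm] k u w; first by rewrite /= scaler0 addr0.
apply/ffunP=> a; rewrite !(boxXE, box_addE, box_scaleE) IHm.
by rewrite mulrnDl scalerDr scalerMnr addrACA.
Qed.

Lemma boxY_linear m : linear (@boxY m).
Proof.
elim: m => [|m IHm] k u w; first by rewrite /= scaler0 addr0.
apply/ffunP=> a; rewrite !(boxYE, box_addE, box_scaleE) IHm.
by rewrite mulrnDl scalerDr scalerMnr addrACA.
Qed.

Lemma boxD_linear m : linear (@boxD m).
Proof.
elim: m => [|m IHm] k u w; first by rewrite /= scaler0 addr0.
apply/ffunP=> a; rewrite !(boxDE, box_addE, box_scaleE) IHm.
by rewrite mulrnDl scalerDr scalerMnr addrACA.
Qed.

HB.instance Definition _ m :=
  GRing.isLinear.Build rat (box m) (box m) _ (@boxX m) (@boxX_linear m).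
HB.instance Definition _ m :=
  GRing.isLinear.Build rat (box m) (box m) _ (@boxY m) (@boxY_linear m).
HB.instance Definition _ m :=
  GRing.isLinear.Build rat (box m) (box m) _ (@boxD m) (@boxD_linear m).

Lemma boxDX m (u : box m) : boxD (boxX u) = boxX (boxD u) + boxX u.
Proof.
elim: m u => [|m IHm] u; first by rewrite /= addr0.
apply/ffunP=> a; rewrite !(boxXE, boxDE, box_addE) !raddfD !raddfMn /= IHm.
case: a => [[|a] lt_am] /=; first by rewrite !mulr0n !addr0.
rewrite inordK 1?ltnW // !mulrnDl -!mulrnA.
have -> : (a.+1 * a.+1 = a * a.+1 + a.+1)%N by lia.
by rewrite mulrnDr !addrA [LHS](ACl (1 * 4 * 3 * 5 * 2 * 6)).
Qed.

Lemma boxDY m (u : box m) : boxD (boxY u) = boxY (boxD u) - boxY u.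
Proof.
apply/eqP; rewrite -subr_eq opprK eq_sym; apply/eqP.
elim: m u => [|m IHm] u; first by rewrite /= addr0.
apply/ffunP=> a; rewrite !(boxYE, boxDE, box_addE) !raddfD !raddfMn /= IHm.
case: (ltnP a m.+1) => [lt_am|le_ma]; last first.
  have /eqP-> : (m.+1 - a == 0)%N by rewrite subn_eq0.
  by rewrite !mulr0n !addr0 addrAC.
rewrite inordK ?ltnS // !mulrnDl -!mulrnA.
set M := (m.+1 - a)%N; have -> : (a.+1 * M = M * a + M)%N by lia.
rewrite mulrnDr !addrA.
by rewrite [LHS](ACl (1 * 4 * 3 * 5 * 2 * 6)).
Qed.

Lemma boxXY m (u : box m) :
  boxX (boxY u) = boxY (boxX u) + boxD u *+ 2 - u *+ 'C(m.+1, 2).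
Proof.
apply/eqP; rewrite eq_sym subr_eq eq_sym; apply/eqP.
elim: m u => [|m IHm] u; first by rewrite /= mul0rn addr0.
rewrite binS bin1; move: 'C(m.+1, 2) IHm => r IHm.
apply/ffunP=> a; rewrite !(box_addE, box_mulnE, boxXE, boxYE, boxDE).
rewrite !(raddfD (@boxX m)) !(raddfD (@boxY m)) !raddfMn /=.
have -> : (boxY (u (inord a.-1))
    + u (inord (inord a.-1 : 'I_m.+2).+1)
      *+ (m.+1 - (inord a.-1 : 'I_m.+2))) *+ a
  = boxY (u (inord a.-1)) *+ a + u a *+ ((m.+2 - a) * a).
  rewrite mulrnDl -mulrnA.
  case: (posnP a) => [->|a_gt0]; first by rewrite !muln0.
  have lt_am := ltn_ord a.
  rewrite inordK ?prednK ?inord_val //; last by rewrite ltnW.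
  by congr (_ + _ *+ (_ * _)); lia.
have -> : (boxX (u (inord a.+1))
    + u (inord (inord a.+1 : 'I_m.+2).-1)
      *+ (inord a.+1 : 'I_m.+2)) *+ (m.+1 - a)
  = boxX (u (inord a.+1)) *+ (m.+1 - a) + u a *+ (a.+1 * (m.+1 - a)).
  case: (ltnP a m.+1) => [lt_am|le_ma].
    by rewrite mulrnDl -mulrnA inordK ?inord_val.
  have /eqP-> : (m.+1 - a == 0)%N by rewrite subn_eq0.
  by rewrite muln0 !mulr0n addr0.
transitivity (boxX (boxY (u a)) + u a *+ r
    + boxX (u (inord a.+1)) *+ (m.+1 - a)
    + boxY (u (inord a.-1)) *+ a + u a *+ ((m.+2 - a) * a + m.+1)).
  by rewrite !mulrnDr !addrA; rewrite [LHS](ACl (1 * 5 * 2 * 3 * 4 * 6)).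
rewrite IHm mulrnDl -mulrnA.
(* The commutator on the new factor alone is [2a - (m+1)]; the terms mixing two factors commute. *)
have -> : ((m.+2 - a) * a + m.+1 = a.+1 * (m.+1 - a) + a * 2)%N.
  have := ltn_ord a; rewrite ltnS => le_am; rewrite subSn //.
  by move: (nat_of_ord a) le_am => b /subnK {2}<-; nia.
rewrite mulrnDr !addrA.
by rewrite [LHS](ACl (1 * 5 * 4 * 6 * 2 * 3 * 7)).
Qed.

Lemma boxD_bound m d (u : box m) :
  ('C(m.+1, 2) < d)%N -> boxD u = u *+ d -> u = 0.
Proof.
elim: m d u => [|m IHm] d u.
  move=> d_gt0 /esym/eqP; rewrite -scaler_nat scaler_eq0 pnatr_eq0.
  by rewrite (gtn_eqF d_gt0) => /eqP.
rewrite binS bin1 => lt_d Du; apply/ffunP=> a; rewrite [RHS]ffunE.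
have lt_am := ltn_ord a.
apply: (IHm (d - a)%N); first by lia.
move/ffunP/(_ a): Du; rewrite boxDE box_mulnE => Dua.
by rewrite mulrnBr -?Dua ?addrK //; lia.
Qed.

Lemma iter_boxX_onto m k (u : box m) : (2 * k <= 'C(m.+1, 2))%N ->
  boxD u = u *+ ('C(m.+1, 2) - k) ->
  exists w, u = iter ('C(m.+1, 2) - 2 * k) (@boxX m) w.
Proof.
move=> le_k Du.
have [w _ ->] :=
  iterX_onto (@boxDX m) (@boxDY m) (@boxXY m) (@boxD_bound m) le_k Du.
by exists w.
Qed.

(** * The map from the tensor product to the nilCoxeter algebra *)

Section Schubert.
Variables (R : pzRingType) (v : nat -> R) (iota : {additive rat -> R}).
Hypothesis v_sq : forall j, v j * v j = 0.
Hypothesis v_comm : forall i j, (i.+1 < j)%N -> v i * v j = v j * v i.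
Hypothesis v_braid : forall j, v j * v j.+1 * v j = v j.+1 * v j * v j.+1.
Hypothesis iota1 : iota 1 = 1.

(* [theta] sends the indicator of [a] to the coefficient of [x^a] in the product
   of the [B_j(x_j)], where [B_j(x) = sum_a (nesym j a) x^a]; the coefficients
   of this product on the permutation basis are the Schubert polynomials. *)
Fixpoint theta m : box m -> R :=
  match m return box m -> R with
  | 0 => fun q => iota q
  | m'.+1 => fun F => \sum_(a < m'.+2) theta (F a) * nesym v m'.+1 a
  end.

Lemma thetaS m (F : box m.+1) :
  theta F = \sum_(a < m.+2) theta (F a) * nesym v m.+1 a.
Proof. by []. Qed.

Lemma theta_additive m : zmod_morphism (@theta m).
Proof.
elim: m => [|m IHm] u w /=; first exact: raddfB.
rewrite -sumrB; apply: eq_bigr => a _.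
by rewrite box_addE box_oppE IHm mulrBl.
Qed.

HB.instance Definition _ m :=
  GRing.isZmodMorphism.Build (box m) R (@theta m) (@theta_additive m).

(** Right multiplication by [wsum] acts on the last factor [nesym] by [nesym_wsum]: the derivative
    term gives the raising operator in the last coordinate, and the remaining [wsum] passes to the
    earlier factors. *)
Lemma theta_boxX m (u : box m) : theta (boxX u) = theta u * wsum v m.
Proof.
elim: m u => [|m IHm] u; first by rewrite /= raddf0 /wsum big_ord0 mulr0.
rewrite !thetaS mulr_suml.
transitivity (\sum_(a < m.+2) (theta (u a) * wsum v m * nesym v m.+1 a
    + theta (u (inord a.-1)) *+ a * nesym v m.+1 a)).
  by apply: eq_bigr => a _; rewrite boxXE raddfD raddfMn /= IHm mulrDl.
transitivity (\sum_(a < m.+2) (theta (u a) * wsum v m * nesym v m.+1 a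
    + theta (u a) * (nesym v m.+1 a.+1 *+ a.+1))); last first.
  apply: eq_bigr => a _.
  by rewrite -[RHS]mulrA nesym_wsum // succnK mulrDr mulrA addrC.
rewrite !big_split /=; congr (_ + _).
(* Index shift: the first term on the left has coefficient zero, and the last on the right contains
   [nesym] beyond its top degree. *)
rewrite big_ord_recl mulr0n mul0r /= add0r [RHS]big_ord_recr /=.
rewrite (nesym_big v (leqnn m.+2)) mul0rn mulr0 addr0.
apply: eq_bigr => a _; rewrite /bump add0n add1n mulrnAl mulrnAr.
congr (theta (u _) * _ *+ _); apply/val_inj.
by rewrite /= inordK // ltnW // ltnS.
Qed.

Lemma theta_iter_boxX m n (u : box m) :
  theta (iter n (@boxX m) u) = theta u * wsum v m ^+ n.
Proof.
by elim: n => [|n IHn]; rewrite ?mulr1 //= theta_boxX IHn exprSr mulrA.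
Qed.

Definition theta_image m d (x : R) :=
  exists2 u : box m, boxD u = u *+ d & theta u = x.

Lemma theta_image0 m d : theta_image m d 0.
Proof. by exists 0; rewrite ?raddf0 // mul0rn. Qed.

Lemma theta_imageD m d x y :
  theta_image m d x -> theta_image m d y -> theta_image m d (x + y).
Proof.
move=> [u Du <-] [w Dw <-]; exists (u + w); last by rewrite raddfD.
by rewrite raddfD /= Du Dw mulrnDl.
Qed.

Lemma theta_imageN m d x : theta_image m d x -> theta_image m d (- x).
Proof.
by move=> [u Du <-]; exists (- u); rewrite raddfN //= Du mulNrn.
Qed.

Lemma theta_image_nesym m d a x : (a <= m.+1)%N ->
  theta_image m d x -> theta_image m.+1 (d + a) (x * nesym v m.+1 a).
Proof.
rewrite -ltnS => lt_am [u Du <-].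
exists ([ffun b => if b == Ordinal lt_am then u else 0] : box m.+1).
  apply/ffunP=> b; rewrite boxDE box_mulnE !ffunE.
  by case: eqP => [->|_]; rewrite ?raddf0 ?mul0rn ?addr0 //= Du mulrnDr.
rewrite /= (bigD1 (Ordinal lt_am)) //= ffunE eqxx big1 ?addr0 //.
move=> b /negbTE nb.
by rewrite ffunE nb raddf0 mul0r.
Qed.

(** Strong induction on the run length: a run is a [nesym], visibly in the image, minus terms with
    shorter runs. *)
Lemma theta_image_crun m :
  (forall d x, wordspan v m d x -> theta_image m d x) ->
  forall d b x, (b <= m.+1)%N -> wordspan v m d x ->
  theta_image m.+1 (d + b) (x * crun v m.+1 b).
Proof.
move=> im d b; elim/ltn_ind: b d => b IHb d x le_bm Wx.
have [t Rt eb] := nesym_crun v_comm le_bm.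
have -> : crun v m.+1 b = nesym v m.+1 b - t by rewrite eb addrK.
rewrite mulrBr; apply: theta_imageD.
  by apply: theta_image_nesym => //; apply: im.
apply: theta_imageN.
suff im_run e y : runspan v m b e y -> theta_image m.+1 (d + e) (x * y).
  exact: im_run.
elim=> {e y} [e c y lt_cb le_cm Wy|e|e y z _ IHy _ IHz].
- by rewrite mulrA addnA; apply: IHb => //; apply: wordspanM.
- by rewrite mulr0; apply: theta_image0.
- by rewrite mulrDr; apply: theta_imageD.
Qed.

(** Surjectivity of [theta] in each degree. Normal forms reduce words in one more letter to shorter
    alphabets followed by a run. *)
Lemma wordspan_theta m d x : wordspan v m d x -> theta_image m d x.
Proof.
elim: m d x => [|m IHm] d x.
  elim=> {d x} [|//|d|d x y _ IHx _ IHy].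
  - by exists (1 : rat^o); rewrite // mulr0n.
  - exact: theta_image0.
  - exact: theta_imageD.
move/(wordspan_runspan v_sq v_comm v_braid).
elim=> {d x} [d b x _ le_bm Wx|d|d x y _ IHx _ IHy].
- exact: theta_image_crun.
- exact: theta_image0.
- exact: theta_imageD.
Qed.

Theorem wordspan_wsum m k x :
  (2 * k <= 'C(m.+1, 2))%N -> wordspan v m ('C(m.+1, 2) - k) x ->
  exists y, x = y * wsum v m ^+ ('C(m.+1, 2) - 2 * k).
Proof.
move=> le_k /wordspan_theta[u Du <-].
have [w ->] := iter_boxX_onto le_k Du.
by exists (theta w); rewrite theta_iter_boxX.
Qed.

End Schubert.

(** * Permutations *)

Section Length.
Variable n : nat.
Implicit Types (u : 'S_n) (x y : 'I_n).

Definition invset u : {set 'I_n * 'I_n} :=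
  [set p : 'I_n * 'I_n | (p.1 < p.2)%N && (u p.2 < u p.1)%N].

Lemma perm_lengthE u : perm_length u = #|invset u|. Proof. by []. Qed.

Lemma tperm_adj_mono x y (a b : 'I_n) : y = x.+1 :> nat -> (a < b)%N ->
  (a, b) != (x, y) -> (tperm x y a < tperm x y b)%N.
Proof.
move=> yx lt_ab ne_ab.
have {}ne_ab : ~ (a = x :> nat /\ b = y :> nat).
  by case=> /val_inj ax /val_inj bY; rewrite ax bY eqxx in ne_ab.
have ne (i j : 'I_n) : i <> j -> i <> j :> nat by move=> ne_ij /val_inj.
case: tpermP => [ax|ay|/ne ax /ne ay]; case: tpermP => [bx|bY|/ne bx /ne bY];
  by subst; lia.
Qed.

(** Exchanging the two positions maps the old inversions injectively to the new ones and misses only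
    the pair [(x, y)]. *)
Lemma perm_length_ascent u x y : y = x.+1 :> nat -> (u x < u y)%N ->
  perm_length (tperm x y * u)%g = (perm_length u).+1.
Proof.
move=> yx lt_u; rewrite !perm_lengthE.
pose phi (p : 'I_n * 'I_n) := (tperm x y p.1, tperm x y p.2).
have phiK : involutive phi by case=> a b; rewrite /phi /= !tpermK.
have -> : invset (tperm x y * u)%g = (x, y) |: phi @: invset u.
  apply/setP=> q; rewrite in_setU1; apply/idP/idP.
    case: eqP => [//|/eqP ne_q] /=; rewrite inE !permM => /andP[lt_q lt_uq].
    apply/imsetP; exists (phi q); rewrite ?phiK // inE /= lt_uq andbT.
    by apply: tperm_adj_mono => //; rewrite -surjective_pairing.
  case/predU1P=> [->|/imsetP[p]].
    by rewrite inE /= !permM tpermL tpermR yx ltnSn.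
  rewrite inE => /andP[lt_p lt_up] ->.
  rewrite inE /= !permM !tpermK lt_up andbT.
  apply: tperm_adj_mono => //; rewrite -surjective_pairing.
  by apply: contraTneq lt_up => ->; rewrite -leqNgt ltnW.
rewrite cardsU1 card_imset ?add1n; last exact: inv_inj.
case: imsetP => // [[p]]; rewrite inE => /andP[lt_p _] [xE yE].
move: lt_p; have -> : p.1 = y by rewrite -[p.1](tpermK x y) -xE tpermL.
have -> : p.2 = x by rewrite -[p.2](tpermK x y) -yE tpermR.
by rewrite yx ltnNge leqnSn.
Qed.

Lemma perm_length_descent u x y : y = x.+1 :> nat -> (u y < u x)%N ->
  perm_length u = (perm_length (tperm x y * u)%g).+1.
Proof.
move=> yx lt_u; rewrite -(perm_length_ascent yx); last first.
  by rewrite !permM tpermL tpermR.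
by rewrite mulgA tperm2 mul1g.
Qed.

Lemma perm_length_adj_le u x y : y = x.+1 :> nat ->
  (perm_length (tperm x y * u)%g <= (perm_length u).+1)%N.
Proof.
move=> yx; case: (ltngtP (u x) (u y)) => [lt_u|lt_u|/val_inj/perm_inj eq_xy].
- by rewrite perm_length_ascent.
- by rewrite [in leqRHS](perm_length_descent yx lt_u) !leqW.
- by move: yx; rewrite eq_xy => /eqP; rewrite eqn_leq ltnn andbF.
Qed.

Lemma perm_length1 : perm_length (1%g : 'S_n) = 0%N.
Proof.
apply/eqP; rewrite perm_lengthE cards_eq0; apply/eqP/setP=> p.
by rewrite !inE !perm1; case: ltngtP.
Qed.

Lemma card_ltn_pairs : #|[set p : 'I_n * 'I_n | (p.1 < p.2)%N]| = 'C(n, 2).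
Proof.
rewrite -bin2_sum big_mkord -sum1dep_card.
rewrite -(pair_big_dep xpredT (fun i j : 'I_n => i < j) (fun _ _ => 1))%N /=.
rewrite (exchange_big_dep xpredT) //=; apply: eq_bigr => j _.
rewrite (big_ord_narrow (ltnW (ltn_ord j))).
by rewrite sum1_card card_ord.
Qed.

Definition rev_perm : 'S_n := perm rev_ord_inj.

(** Reversing the positions turns inversions into non-inversions, so the two inversion sets, after
    reflection, partition all pairs. *)
Lemma perm_length_rev u :
  (perm_length (rev_perm * u)%g + perm_length u = 'C(n, 2))%N.
Proof.
pose phi (p : 'I_n * 'I_n) := (rev_ord p.2, rev_ord p.1).
have phiK : involutive phi by case=> a b; rewrite /phi /= !rev_ordK.
have rev_lt (a b : 'I_n) : (rev_ord a < rev_ord b)%N = (b < a)%N.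
  by have := ltn_ord a; have := ltn_ord b; rewrite /=; lia.
rewrite !perm_lengthE -(card_imset _ (inv_inj phiK)) -card_ltn_pairs.
have memE p : (p \in phi @: invset (rev_perm * u)%g)
    = (p.1 < p.2)%N && (u p.1 < u p.2)%N.
  rewrite -{1}[p]phiK mem_imset; last exact: inv_inj.
  by rewrite !inE /= !permM !permE !rev_ordK rev_lt.
have -> : [set p : 'I_n * 'I_n | (p.1 < p.2)%N]
    = phi @: invset (rev_perm * u)%g :|: invset u.
  apply/setP=> p; rewrite in_setU memE !inE.
  case: (ltnP p.1 p.2) => //= lt_p; case: ltngtP => // /val_inj/perm_inj eq_p.
  by rewrite eq_p ltnn in lt_p.
rewrite -cardsUI; have -> : phi @: invset (rev_perm * u)%g :&: invset u = set0.
  apply/setP=> p; rewrite in_setI memE !inE.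
  by case: (ltngtP (u p.1) (u p.2)); rewrite ?andbF.
by rewrite cards0 addn0.
Qed.

End Length.

(** * The weighted raising operator of the weak order *)

Section WeakLefschetz.
Variable k : nat.
Local Notation P := (weak_order k.+1).
Local Notation len := (@perm_length k.+1).
Local Notation N := #|P|.

Definition adj (j : nat) : 'S_k.+1 := tperm (inord j) (inord j.+1).
Definition step (u : P) (j : nat) : P := (adj j * u)%g.

Lemma adj_succ j : (j < k)%N ->
  (inord j.+1 : 'I_k.+1) = (inord j : 'I_k.+1).+1 :> nat.
Proof. by move=> lt_jk; rewrite !inordK // ltnS ltnW. Qed.

Lemma step2 u i : step (step u i) i = u.
Proof. by rewrite /step /adj mulgA tperm2 mul1g. Qed.

Lemma len_step u j : (j < k)%N -> (len (step u j) <= (len u).+1)%N.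
Proof. by move/adj_succ; apply: perm_length_adj_le. Qed.

Lemma adj_comm i j : (i.+1 < j)%N -> (j < k)%N ->
  (adj i * adj j = adj j * adj i)%g.
Proof.
move=> lt_ij lt_jk; rewrite conjgC; congr (_ * _)%g.
by rewrite /adj tpermJ !tpermD // -val_eqE /= !inordK //; lia.
Qed.

Lemma adj_braid j : (j.+1 < k)%N ->
  (adj j * adj j.+1 * adj j = adj j.+1 * adj j * adj j.+1)%g.
Proof.
move=> lt_jk.
have -> : (adj j * adj j.+1 * adj j = adj j.+1 ^ adj j)%g.
  by rewrite /conjg [((adj j)^-1)%g]tpermV mulgA.
have -> : (adj j.+1 * adj j * adj j.+1 = adj j ^ adj j.+1)%g.
  by rewrite /conjg [((adj j.+1)^-1)%g]tpermV mulgA.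
rewrite /adj !tpermJ tpermL tpermR !tpermD // -val_eqE /= !inordK //; lia.
Qed.

(** Matrices act on row vectors from the right. The guard [j < k] makes the operator vanish out of
    range, so the nilCoxeter relations hold for all indices. *)
Definition raise (j : nat) : 'M[rat]_N := \matrix_(a, b)
  [&& (j < k)%N, enum_val b == step (enum_val a) j
    & len (enum_val b) == (len (enum_val a)).+1]%:R.

Definition basis (u : P) : 'rV[rat]_N := delta_mx 0 (enum_rank u).

Lemma basis_raise u j : basis u *m raise j =
  if (j < k)%N && (len (step u j) == (len u).+1) then basis (step u j) else 0.
Proof.
apply/rowP=> b; rewrite -rowE !mxE enum_rankK.
case: (j < k)%N => /=; last by rewrite mxE.
case: eqP => [eq_b|ne_b] /=.
  by rewrite eq_b; case: eqP => _; rewrite mxE // -eq_b enum_valK !eqxx.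
case: ifP => _; rewrite !mxE ?eqxx //=.
by case: eqP => // eq_b; case: ne_b; rewrite eq_b enum_rankK.
Qed.

Lemma len_foldl_step u w : all (fun j => (j < k)%N) w ->
  (len (foldl step u w) <= len u + size w)%N.
Proof.
elim: w u => [|j w IHw] u /=; first by rewrite addn0.
case/andP=> lt_jk /(IHw (step u j)) le_len.
by apply: leq_trans le_len _; rewrite addnS -addSn leq_add2r len_step.
Qed.

(* A step raises the length by at most one, so a product of raising operators
   depends only on the product of the transpositions and the final length. *)
Lemma basis_word u w : basis u *m (\prod_(j <- w) raise j) =
  if all (fun j => (j < k)%N) w && (len (foldl step u w) == len u + size w)%N
  then basis (foldl step u w) else 0.
Proof.
elim: w u => [|j w IHw] u; first by rewrite big_nil /= addn0 eqxx mulmx1.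
rewrite big_cons mulmxA basis_raise /=.
case: (ltnP j k) => lt_jk /=; last by rewrite mul0mx.
case: eqP => [len_u|/eqP ne_len]; first by rewrite IHw len_u addSnnS.
rewrite mul0mx; case: ifP => // /andP[all_w /eqP len_w].
have := len_foldl_step (step u j) all_w; rewrite len_w addnS ltn_add2r.
by rewrite leqNgt ltn_neqAle ne_len len_step.
Qed.

Lemma row_basis_inj (A B : 'M[rat]_N) :
  (forall u, basis u *m A = basis u *m B) -> A = B.
Proof.
move=> eqAB; apply/row_matrixP=> i; rewrite !rowE.
by have := eqAB (enum_val i); rewrite /basis enum_valK.
Qed.

Lemma raise_sq j : raise j * raise j = 0.
Proof.
apply: row_basis_inj => u; rewrite mulmx0.
have := basis_word u [:: j; j]; rewrite !big_cons big_nil mulr1 => ->.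
by case: ifP => //= /andP[_]; rewrite step2 -[X in X == _]addn0 eqn_add2l.
Qed.

Lemma raise_comm i j : (i.+1 < j)%N -> raise i * raise j = raise j * raise i.
Proof.
move=> lt_ij; apply: row_basis_inj => u.
have := basis_word u [:: i; j]; have := basis_word u [:: j; i].
rewrite !big_cons !big_nil !mulr1 => -> -> /=.
case: (ltnP j k) => lt_jk; last by rewrite !andbF.
by rewrite /= !andbT /step !mulgA (adj_comm lt_ij).
Qed.

Lemma raise_braid j :
  raise j * raise j.+1 * raise j = raise j.+1 * raise j * raise j.+1.
Proof.
apply: row_basis_inj => u.
have := basis_word u [:: j; j.+1; j]; have := basis_word u [:: j.+1; j; j.+1].
rewrite !big_cons !big_nil !mulr1 -!mulrA => -> -> /=.
case: (ltnP j.+1 k) => lt_jk; last by rewrite !andbF.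
by rewrite (ltnW lt_jk) /step !mulgA adj_braid.
Qed.

(** An increasing word satisfies [i <= u i] counting from the left and [u i <= i] counting from the
    right. *)
Lemma no_descent_id (u : 'S_k.+1) :
  (forall j, (j < k)%N -> (u (inord j) < u (inord j.+1))%N) -> u = 1%g.
Proof.
move=> incr.
have ge i : (i <= k)%N -> (i <= u (inord i))%N.
  elim: i => // i IHi lt_ik; apply: leq_ltn_trans (incr i lt_ik).
  by apply: IHi; apply: ltnW.
have le i : (i <= k)%N -> (u (inord (k - i)) <= k - i)%N.
  elim: i => [_|i IHi lt_ik]; first by rewrite subn0 -ltnS.
  have lt_k : (k - i.+1 < k)%N by lia.
  have := incr _ lt_k; have -> : ((k - i.+1).+1 = k - i)%N by lia.
  by have := IHi (ltnW lt_ik); lia.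
apply/permP=> i; rewrite perm1; apply/val_inj/eqP; rewrite /= eqn_leq.
have le_ik : (i <= k)%N by rewrite -ltnS.
have := ge i le_ik; rewrite inord_val => ->.
by have := le (k - i)%N (leq_subr _ _); rewrite subKn // inord_val => ->.
Qed.

(** Removing descents one by one yields a reduced word from the identity to [u]. *)
Lemma basis_wordspan u : exists2 x, wordspan raise k (len u) x
  & basis u = basis (1%g : 'S_k.+1) *m x.
Proof.
have [d] := ubnP (len u); elim: d u => // d IHd u lt_ud.
have [/existsP[j lt_u]|no_desc] :=
  boolP [exists j : 'I_k, (u (inord j.+1) < u (inord j))%N]; last first.
  have -> : u = 1%g :> 'S_k.+1.
    apply: no_descent_id => j lt_jk; rewrite ltn_neqAle leqNgt.
    rewrite (existsPn no_desc (Ordinal lt_jk)) andbT; apply/eqP.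
    by move/val_inj/perm_inj=> eq_j; have := adj_succ lt_jk; rewrite -eq_j; lia.
  by exists 1; rewrite ?mulmx1 // perm_length1; apply: Wordspan1.
have len_u := perm_length_descent (adj_succ (ltn_ord j)) lt_u.
have [|x Wx def_x] := IHd (step u j); first by rewrite -ltnS -len_u.
exists (x * raise j); first by rewrite len_u; apply: WordspanMv.
by rewrite mulmxA -def_x basis_raise step2 ltn_ord -len_u eqxx.
Qed.

Lemma weak_lefschetz i u : (2 * i <= 'C(k.+1, 2))%N ->
  len u = ('C(k.+1, 2) - i)%N ->
  exists z, basis u = z *m wsum raise k ^+ ('C(k.+1, 2) - 2 * i).
Proof.
move=> le_i len_u; have [x] := basis_wordspan u; rewrite len_u => Wx ->.
(* Scalar matrices serve as the additive map [iota] from the rationals. *)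
have sc1 : (scalar_mx 1 : 'M[rat]_N) = 1 by [].
have [y ->] := @wordspan_wsum _ _ (@scalar_mx rat N)
  raise_sq raise_comm raise_braid sc1 _ _ _ le_i Wx.
by exists (basis (1%g : 'S_k.+1) *m y); rewrite mulmxA.
Qed.

Lemma wsum_raise_cover a b :
  wsum raise k a b != 0 -> covers (enum_val a : P) (enum_val b).
Proof.
rewrite /wsum summxE => nz; apply/weak_coversP.
have [j nz_j] : exists j : 'I_k, raise j a b != 0.
  apply/existsP; apply: contraNT nz => /existsPn no_j; apply/eqP.
  apply: big1 => j _; move/(_ j): no_j; rewrite negbK => /eqP raise0.
  by rewrite mulmxnE raise0 mul0rn.
move: nz_j; rewrite mxE pnatr_eq0 eqb0 negbK => /and3P[lt_jk /eqP def_b len_b].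
rewrite /weak_cover len_b andbT; apply/existsP; exists (inord j).
apply/existsP; exists (inord j.+1); rewrite def_b eqxx andbT; apply/eqP.
exact: adj_succ.
Qed.

Lemma weak_rank_symmetric : rank_symmetric P.
Proof.
move=> i le_i.
have inj : injective (fun u : P => (rev_perm k.+1 * u)%g : P) by apply: mulgI.
rewrite -(card_imset _ inj); apply: eq_card => u.
rewrite -[u](mulKVg (rev_perm k.+1)) mem_imset //.
have := perm_length_rev ((rev_perm k.+1)^-1 * u)%g; rewrite !inE /=.
by move: le_i => /=; move: (len _) (len _) => a b le_i ab; apply/eqP/eqP; lia.
Qed.

End WeakLefschetz.

(** * Disjoint chains from determinants *)

(** Multilinearity in the rows. The sum runs over all maps [h], not over subsets as in Cauchy-Binet;
    this is enough to extract one nonzero term. *)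
Lemma det_mulmx_expand (F : comPzRingType) p q
    (A : 'M[F]_(p, q)) (B : 'M[F]_(q, p)) :
  \det (A *m B) =
  \sum_(h : {ffun 'I_p -> 'I_q}) (\prod_i A i (h i)) * \det (rowsub h B).
Proof.
rewrite /determinant.
under eq_bigr => s _ do under eq_bigr => i _ do rewrite mxE.
under eq_bigr => s _ do rewrite bigA_distr_bigA big_distrr /=.
rewrite exchange_big /=; apply: eq_bigr => h _; rewrite big_distrr /=.
apply: eq_bigr => s _; rewrite big_split /= mulrCA; congr (_ * (_ * _)).
by apply: eq_bigr => i _; rewrite mxE.
Qed.

Section DetChains.
Variables (F : fieldType) (N p : nat).
Implicit Types (M : 'M[F]_N) (f g : 'I_p -> 'I_N).

Lemma det_mxsub_inj M f g : \det (mxsub f g M) != 0 -> injective f.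
Proof.
move=> nz i1 i2 eq_f; apply: contraNeq nz => ne_i; apply/eqP.
by apply: (determinant_alternate ne_i) => j; rewrite !mxE eq_f.
Qed.

(** Peeling off one factor [M], a nonzero term of the expansion gives the next row of points [h],
    joined to [f] by nonzero entries, and a nonzero minor for the remaining power. A nonzero minor
    has distinct row indices, whence disjointness. *)
Lemma det_chains M t f g : \det (mxsub f g (M ^+ t)) != 0 ->
  exists c : nat -> 'I_p -> 'I_N,
    [/\ c 0%N = f, forall j, (j <= t)%N -> injective (c j)
      & forall j i, (j < t)%N -> M (c j i) (c j.+1 i) != 0].
Proof.
elim: t f => [|t IHt] f nz; have f_inj := det_mxsub_inj nz.
  by exists (fun=> f).
have : \det (rowsub f M *m colsub g (M ^+ t)) != 0.
  congr (\det _ != 0): nz; rewrite exprS; apply/matrixP=> i j.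
  by rewrite !mxE; apply: eq_bigr => l _; rewrite !mxE.
rewrite det_mulmx_expand => nz_sum.
have /existsP[h] : [exists h : {ffun 'I_p -> 'I_N},
    (\prod_i rowsub f M i (h i)) * \det (rowsub h (colsub g (M ^+ t))) != 0].
  apply: contraNT nz_sum => /existsPn h0; apply/eqP/big1 => h _.
  by apply/eqP; rewrite -[_ == _]negbK h0.
rewrite mulf_eq0 negb_or => /andP[nz_f nz_h].
have [|c [c0 c_inj c_nz]] := IHt h.
  by congr (\det _ != 0): nz_h; apply/matrixP=> i j; rewrite !mxE.
exists (fun j => if j is j'.+1 then c j' else f); split=> // [[|j]|[|j] i] //.
- exact: c_inj.
- by rewrite c0 => _; move/prodf_neq0/(_ i isT): nz_f; rewrite mxE.
- exact: c_nz.
Qed.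

End DetChains.

(** Used to compare the middle ranks with the largest ones. Greedy exchange: the head of [s]
    replaces itself in [t] if present, and otherwise any element of [t]. *)
Lemma sum_le_take_sorted (f : nat -> nat) s t :
  sorted (fun i j => (f j <= f i)%N) s -> uniq t -> {subset t <= s} ->
  (\sum_(i <- t) f i <= \sum_(i <- take (size t) s) f i)%N.
Proof.
elim: s t => [|x s IHs] t.
  case: t => [|y t] _ _ sub_t; first by rewrite big_nil.
  by have := sub_t y (mem_head y t).
rewrite [sorted _ _]/(path _ x s) => path_s uniq_t sub_t.
have sorted_s := path_sorted path_s.
have le_x y : y \in s -> (f y <= f x)%N.
  have tr : transitive (fun i j => (f j <= f i)%N).
    by move=> j i l /= ji lj; apply: leq_trans ji.
  by move/(order_path_min tr): path_s => /allP; apply.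
case: t uniq_t sub_t => [|y t] uniq_t sub_t; first by rewrite !big_nil.
have [z z_t [le_zx sub_s]] : exists2 z, z \in y :: t &
    (f z <= f x)%N /\ {subset rem z (y :: t) <= s}.
  case: (boolP (x \in y :: t)) => x_t.
    exists x => //; split=> // w.
    rewrite mem_rem_uniq // inE => /andP[ne_wx /sub_t].
    by rewrite inE (negbTE ne_wx).
  have sub w : w \in y :: t -> w \in s.
    move=> w_t; have := sub_t w w_t; rewrite inE => /predU1P[eq_w|//].
    by rewrite -eq_w w_t in x_t.
  exists y; first exact: mem_head.
  split=> [|w /mem_rem/sub //]; apply/le_x/sub/mem_head.
rewrite (perm_big _ (perm_to_rem z_t)) big_cons /= big_cons leq_add //.
have -> : size t = size (rem z (y :: t)) by rewrite size_rem.
exact: IHs sorted_s (rem_uniq z uniq_t) sub_s.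
Qed.

(** * Posets with a Lefschetz operator *)

Lemma inj_card_onto (T : finType) p (f : 'I_p -> T) (A : {set T}) :
  injective f -> (forall i, f i \in A) -> #|A| = p ->
  forall x, x \in A -> exists i, x = f i.
Proof.
move=> f_inj fA cardA x xA.
have sub : f @: [set: 'I_p] \subset A by apply/subsetP=> _ /imsetP[i _ ->].
have /eqP eqA : f @: [set: 'I_p] == A.
  by rewrite eqEcard sub card_imset // cardsT card_ord cardA /=.
by move: xA; rewrite -eqA => /imsetP[i _ ->]; exists i.
Qed.

Section Lefschetz.
Variables (d : Order.disp_t) (P : rankedPoset d) (M : 'M[rat]_#|P|).
Local Notation r := (toprank P).
Local Notation rk := (@rank d P).
Hypothesis M_covers : forall a b,
  M a b != 0 -> covers (enum_val a : P) (enum_val b).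
Hypothesis sym : rank_symmetric P.
Hypothesis M_onto : forall k (y : P), (2 * k <= r)%N -> rk y = (r - k)%N ->
  exists z, (delta_mx 0 (enum_rank y) : 'rV[rat]_#|P|) = z *m M ^+ (r - 2 * k).

Lemma M_power_support t a b : (M ^+ t) a b != 0 ->
  rk (enum_val b) = (rk (enum_val a) + t)%N.
Proof.
elim: t b => [|t IHt] b.
  rewrite expr0 mxE pnatr_eq0 eqb0 negbK => /eqP->.
  by rewrite addn0.
rewrite exprSr mxE => nz.
have /existsP[l] : [exists l, (M ^+ t) a l * M l b != 0].
  apply: contraNT nz => /existsPn h0; apply/eqP/big1 => l _.
  by apply/eqP; rewrite -[_ == _]negbK h0.
rewrite mulf_eq0 negb_or => /andP[/IHt rk_l /M_covers/rank_covers->].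
by rewrite rk_l addnS.
Qed.

(** By [M_onto] the block of the power of [M] between ranks [k] and [r - k], square by symmetry, is
    invertible, so [det_chains] applies; covers fix the ranks along each chain. *)
Lemma saturated_chains k : (2 * k <= r)%N ->
  exists c : nat -> 'I_#|level P k| -> P,
  [/\ forall j i, (j <= r - 2 * k)%N -> rk (c j i) = (k + j)%N,
      forall j, (j <= r - 2 * k)%N -> injective (c j)
    & forall j i, (j < r - 2 * k)%N -> (c j i < c j.+1 i)%O].
Proof.
move=> le_k; set p := #|level P k|; set t := (r - 2 * k)%N.
have cardr : p = #|level P (r - k)| by rewrite -sym //; lia.
pose f (i : 'I_p) := enum_rank (enum_val i : P).
pose g (i : 'I_p) := enum_rank (enum_val (cast_ord cardr i) : P).
have g_rk i : rk (enum_val (g i)) = (r - k)%N.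
  rewrite enum_rankK; have := enum_valP (cast_ord cardr i).
  by rewrite inE => /eqP.
have f_rk i : rk (enum_val (f i)) = k.
  by rewrite enum_rankK; have := enum_valP i; rewrite inE => /eqP.
have nz : \det (mxsub f g (M ^+ t)) != 0.
  have /fin_all_exists[z zE] i := M_onto le_k (g_rk i).
  (* The rows are the preimages [z i] restricted to rank [k]; their other entries contribute
     nothing, because [M ^+ t] raises rank by exactly [t]. *)
  pose Z : 'M[rat]_p := \matrix_(i, j) z i 0 (f j).
  suff ZM : Z *m mxsub f g (M ^+ t) = 1%:M.
    have := det1 rat p; rewrite -ZM det_mulmx => /eqP.
    by apply: contraTneq => ->; rewrite mulr0 eq_sym oner_eq0.
  apply/matrixP=> i j; rewrite !mxE.
  have := congr1 (fun A : 'rV_#|P| => A 0 (g j)) (zE i).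
  rewrite enum_valK !mxE eqxx /= => gE.
  have -> : (i == j) = (g j == g i).
    apply/eqP/eqP => [->//|/enum_rank_inj/enum_val_inj/cast_ord_inj//].
  rewrite gE [RHS](bigID (fun l => rk (enum_val l) == k)) /=.
  rewrite [X in _ = _ + X]big1 ?addr0.
    rewrite (reindex_onto (@enum_rank P) enum_val) /=; last first.
      by move=> l _; rewrite enum_valK.
    rewrite (eq_bigl (fun x => x \in level P k)); last first.
      by move=> x; rewrite enum_rankK eqxx andbT inE.
    rewrite [RHS]big_enum_val.
    by apply: eq_bigr => l _; rewrite !mxE.
  move=> l ne_l; apply/eqP; rewrite mulf_eq0; apply/orP; right.
  apply: contraNT ne_l => /M_power_support; rewrite g_rk.
  by move: (rk _) le_k; clear=> rk_l le_k rE; apply/eqP; lia.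
have [c [c0 c_inj c_nz]] := det_chains nz.
exists (fun j i => enum_val (c j i)).
have c_cov j i : (j < t)%N ->
    covers (enum_val (c j i) : P) (enum_val (c j.+1 i)).
  by move=> lt_jt; apply/M_covers/c_nz.
split=> [j i|j le_jt i1 i2 /enum_val_inj/c_inj-> //|j i /(c_cov j i)[] //].
elim: j => [_|j IHj lt_jt]; first by rewrite addn0 c0.
by rewrite (rank_covers (c_cov j i lt_jt)) IHj 1?ltnW // addnS.
Qed.

(** The first steps of the saturated chains: there are as many chains as elements of rank [k], so
    every such element starts one. *)
Lemma up_injection k : (2 * k < r)%N -> exists phi : P -> P,
  {in level P k &, injective phi} /\
  {in level P k, forall x, rk (phi x) = k.+1 /\ (x < phi x)%O}.
Proof.
move=> lt_k; have [c [c_rk c_inj c_lt]] := saturated_chains (ltnW lt_k).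
have t_gt0 : (0 < r - 2 * k)%N by rewrite subn_gt0.
pose phi x := if [pick i | x == c 0%N i] is Some i then c 1%N i else x.
have phiE i : phi (c 0%N i) = c 1%N i.
  rewrite /phi; case: pickP => [l /eqP/c_inj-> //|/(_ i)].
  by rewrite eqxx.
have onto := inj_card_onto (c_inj _ (ltnW t_gt0)) _ erefl.
have{onto} c0 x : x \in level P k -> exists i, x = c 0%N i.
  by apply: onto => i; rewrite inE c_rk // addn0.
exists phi; split=> [x y /c0[i ->] /c0[l ->]|x /c0[i ->]]; rewrite !phiE.
  by move/c_inj->.
by rewrite c_rk // addn1; split=> //; apply: c_lt.
Qed.

Lemma down_injection k : (r < 2 * k)%N -> (k <= r)%N -> exists psi : P -> P,
  {in level P k &, injective psi} /\
  {in level P k, forall x, (rk (psi x)).+1 = k /\ (psi x < x)%O}.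
Proof.
move=> lt_r le_k; have le_k' : (2 * (r - k) <= r)%N by lia.
have [c [c_rk c_inj c_lt]] := saturated_chains le_k'.
have [t tE] : exists t, (r - 2 * (r - k) = t.+1)%N.
  by exists (r - 2 * (r - k)).-1; lia.
rewrite tE in c_rk c_inj c_lt.
pose psi x := if [pick i | x == c t.+1 i] is Some i then c t i else x.
have psiE i : psi (c t.+1 i) = c t i.
  rewrite /psi; case: pickP => [l /eqP/c_inj-> //|/(_ i)].
  by rewrite eqxx.
have ct x : x \in level P k -> exists i, x = c t.+1 i.
  apply: inj_card_onto => [|i|]; first exact: c_inj.
    by rewrite inE c_rk //; lia.
  by rewrite sym // subKn.
exists psi; split=> [x y /ct[i ->] /ct[l ->]|x /ct[i ->]]; rewrite !psiE.
  by move/c_inj->.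
by rewrite c_rk ?leqnSn //; split; [lia | apply: c_lt].
Qed.

(** A partial chain partition of the window of ranks, [None] marking elements in no chain. Applied
    in both directions at equal rank, it shows that a label occurs at most once per rank. *)
Definition chain_labels p (lo hi : nat) (lab : P -> option 'I_p) :=
  forall x y i, (lo <= rk x)%N -> (rk x <= rk y)%N -> (rk y <= hi)%N ->
    lab x = Some i -> lab y = Some i -> (x <= y)%O.

(** Each element of rank [lo] joins the chain of its image under [phi]; injectivity prevents two of
    them from joining the same chain. *)
Lemma chain_labels_low p lo hi (lab : P -> option 'I_p) phi :
  {in level P lo &, injective phi} ->
  {in level P lo, forall x, rk (phi x) = lo.+1 /\ (x < phi x)%O} ->
  (lo < hi)%N -> chain_labels lo.+1 hi lab ->
  chain_labels lo hi (fun x => if rk x == lo then lab (phi x) else lab x).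
Proof.
move=> phi_inj phiP lt_lo labP x y i; rewrite leq_eqVlt => /predU1P[lo_x|lt_x].
  have lev_x : x \in level P lo by rewrite inE lo_x.
  have [rk_phix lt_phix] := phiP x lev_x.
  move=> le_xy; rewrite -lo_x eqxx.
  case: eqP => [lo_y|/eqP ne_y] le_y lab_x lab_y.
    have lev_y : y \in level P lo by rewrite inE lo_y.
    have [rk_phiy _] := phiP y lev_y.
    suff -> : x = y by apply: lexx.
    apply: phi_inj => //; apply: le_anti; apply/andP; split.
      by apply: labP lab_x lab_y; rewrite ?rk_phix ?rk_phiy.
    by apply: labP lab_y lab_x; rewrite ?rk_phix ?rk_phiy.
  have lt_y : (lo < rk y)%N by rewrite ltn_neqAle eq_sym ne_y lo_x.
  by apply: le_trans (ltW lt_phix) _; apply: labP lab_x lab_y; rewrite ?rk_phix.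
move=> le_xy le_y; have lt_y := leq_trans lt_x le_xy.
by rewrite !gtn_eqF //; apply: labP.
Qed.

Lemma chain_labels_high p lo hi (lab : P -> option 'I_p) psi :
  {in level P hi.+1 &, injective psi} ->
  {in level P hi.+1, forall x, (rk (psi x)).+1 = hi.+1 /\ (psi x < x)%O} ->
  (lo <= hi)%N -> chain_labels lo hi lab ->
  chain_labels lo hi.+1 (fun x => if rk x == hi.+1 then lab (psi x) else lab x).
Proof.
move=> psi_inj psiP le_lo labP x y i lo_x le_xy.
rewrite leq_eqVlt => /predU1P[hi_y|lt_y].
  have lev_y : y \in level P hi.+1 by rewrite inE hi_y.
  have [[rk_psiy] lt_psiy] := psiP y lev_y.
  rewrite hi_y eqxx; case: eqP => [hi_x|/eqP ne_x] lab_x lab_y.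
    have lev_x : x \in level P hi.+1 by rewrite inE hi_x.
    have [[rk_psix] _] := psiP x lev_x.
    suff -> : x = y by apply: lexx.
    apply: psi_inj => //; apply: le_anti; apply/andP; split.
      by apply: labP lab_x lab_y; rewrite ?rk_psix ?rk_psiy.
    by apply: labP lab_y lab_x; rewrite ?rk_psix ?rk_psiy.
  have lt_x : (rk x <= hi)%N by rewrite -ltnS ltn_neqAle ne_x -hi_y.
  by apply: le_trans _ (ltW lt_psiy); apply: labP lab_x lab_y; rewrite ?rk_psiy.
have lt_x := leq_ltn_trans le_xy lt_y.
by rewrite !ltn_eqF //; apply: labP.
Qed.

(** The saturated chains label the window from [a] to [r - a], which then grows by one rank at each
    end, [e] counting the growth. The chains fill both end ranks of the initial window, so only
    elements strictly between can stay unlabelled. *)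
Lemma chain_labeling a : (2 * a <= r)%N ->
  exists c : nat -> 'I_#|level P a| -> P,
  exists lab : P -> option 'I_#|level P a|,
  [/\ forall j i, (j <= r - 2 * a)%N ->
        rk (c j i) = (a + j)%N /\ lab (c j i) = Some i,
      chain_labels 0 r lab
    & forall x, lab x = None -> (a < rk x < r - a)%N].
Proof.
move=> le_a; have [c [c_rk c_inj c_lt]] := saturated_chains le_a.
exists c; set t := (r - 2 * a)%N in c_rk c_inj c_lt *.
have c_mono i j1 j2 : (j1 <= j2 <= t)%N -> (c j1 i <= c j2 i)%O.
  case/andP=> le_j; elim: j2 le_j => [|j2 IHj].
    by rewrite leqn0 => /eqP-> _; apply: lexx.
  rewrite leq_eqVlt => /predU1P[-> _|le_j lt_j]; first exact: lexx.
  by apply: le_trans (IHj le_j (ltnW lt_j)) _; apply/ltW/c_lt.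
suff lab_ext e : (e <= a)%N -> exists lab : P -> option 'I_#|level P a|,
    [/\ forall j i, (j <= t)%N -> lab (c j i) = Some i,
        chain_labels (a - e) (r - a + e) lab
      & forall x, (a - e <= rk x)%N -> (rk x <= r - a + e)%N ->
          lab x = None -> (a < rk x < r - a)%N].
  have [lab [labc labP labN]] := lab_ext a (leqnn a).
  have hiE : (r - a + a = r)%N by lia.
  rewrite subnn hiE in labP labN.
  exists lab; split=> // [j i le_j|x].
    by split; [apply: c_rk | apply: labc].
  by apply: labN; rewrite ?rank_leq.
elim: e => [_|e IHe lt_e].
  pose lab x := [pick i | [exists j : 'I_t.+1, x == c j i]].
  have labS x i : lab x = Some i -> exists2 j, (j <= t)%N & x = c j i.
    rewrite /lab; case: pickP => // l /existsP[j /eqP->] [<-].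
    by exists j; rewrite // -ltnS.
  have labc j i : (j <= t)%N -> lab (c j i) = Some i.
    move=> le_j; case labE: (lab (c j i)) => [l|].
      have [j' le_j' eq_c] := labS _ _ labE.
      have := congr1 rk eq_c; rewrite !c_rk // => /addnI eq_j.
      by move: eq_c; rewrite -eq_j => /c_inj->.
    move: labE; rewrite /lab; case: pickP => // /(_ i) /existsP[].
    by exists (Ordinal (le_j : (j < t.+1)%N)).
  exists lab; split=> // [x y i|x].
    rewrite subn0 addn0 => _ le_xy _ /labS[j le_j xE] /labS[l le_l yE].
    move: le_xy; rewrite xE yE !c_rk // leq_add2l => le_jl.
    by apply: c_mono; rewrite le_jl.
  rewrite subn0 addn0 => le_x ge_x labN.
  (* At rank [a] or [r - a] the element would be an endpoint of some chain, hence labelled. *)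
  rewrite !ltn_neqAle le_x ge_x !andbT; apply/andP; split; apply/eqP => rk_x.
    have [||i def_x] := @inj_card_onto P _ (c 0%N) (level P a)
      (c_inj _ (leq0n _)) _ erefl x.
    - by move=> i; rewrite inE c_rk // addn0.
    - by rewrite inE rk_x.
    by rewrite def_x labc in labN.
  have [|||i def_x] := @inj_card_onto P _ (c t) (level P (r - a))
    (c_inj _ (leqnn _)) _ _ x.
  - by move=> i; rewrite inE c_rk //; apply/eqP; rewrite /t; lia.
  - by rewrite sym ?subKn //; lia.
  - by rewrite inE rk_x.
  by rewrite def_x labc in labN.
have [lab [labc labP labN]] := IHe (ltnW lt_e).
set lo := (a - e.+1)%N; set hi := (r - a + e)%N.
have loE : (a - e = lo.+1)%N by rewrite /lo; lia.
have [phi [phi_inj phiP]] : exists phi : P -> P,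
    {in level P lo &, injective phi} /\
    {in level P lo, forall x, rk (phi x) = lo.+1 /\ (x < phi x)%O}.
  by apply: up_injection; rewrite /lo; lia.
have [psi [psi_inj psiP]] : exists psi : P -> P,
    {in level P hi.+1 &, injective psi} /\
    {in level P hi.+1, forall x, (rk (psi x)).+1 = hi.+1 /\ (psi x < x)%O}.
  by apply: down_injection; rewrite /hi; lia.
have lt_lohi : (lo < hi)%N by rewrite /lo /hi; lia.
rewrite loE -/hi in labP labN.
have labP1 := chain_labels_low phi_inj phiP lt_lohi labP.
have labP2 := chain_labels_high psi_inj psiP (ltnW lt_lohi) labP1.
move: labP2; set lab' := (fun x => _) => labP2.
exists lab'; rewrite addnS -/hi; split=> // [j i le_j|x ge_x le_x].
  have rk_c := c_rk j i le_j.
  rewrite /lab' !ifF ?labc //; apply/eqP; rewrite rk_c /hi /lo; lia.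
rewrite /lab'; case: eqP => [hi_x|/eqP ne_hi].
  have [[rk_psi] _] : (rk (psi x)).+1 = hi.+1 /\ (psi x < x)%O.
    by apply: psiP; rewrite inE hi_x.
  rewrite ifF; last by rewrite rk_psi gtn_eqF.
  by move/labN; rewrite rk_psi => /(_ lt_lohi (leqnn _)); rewrite /hi; lia.
case: eqP => [lo_x|/eqP ne_lo].
  have [rk_phi _] : rk (phi x) = lo.+1 /\ (x < phi x)%O.
    by apply: phiP; rewrite inE lo_x.
  by move/labN; rewrite rk_phi => /(_ (leqnn _) lt_lohi); rewrite /lo; lia.
by apply: labN; rewrite ?(ltn_neqAle lo) 1?eq_sym ?ne_lo // -ltnS ltn_neqAle
  ne_hi.
Qed.

Lemma card_bigcup_levels (s : seq nat) : uniq s ->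
  #|\bigcup_(i <- s) level P i| = (\sum_(i <- s) #|level P i|)%N.
Proof.
elim: s => [|i s IHs] /=; first by rewrite !big_nil cards0.
case/andP=> ni us; rewrite !big_cons cardsU IHs //.
rewrite [X in (_ - #|pred_of_set X|)%N](_ : _ = set0) ?cards0 ?subn0 //.
apply/setP=> x; rewrite !inE; apply/andP=> [[/eqP rk_x]].
elim: s ni {IHs us} => [|j s IHs]; first by rewrite big_nil inE.
rewrite inE negb_or big_cons in_setU => /andP[ne_ij /IHs ns] /orP[|//].
by rewrite inE rk_x (negbTE ne_ij).
Qed.

(** The union of the antichains injects into [q] middle ranks: a labelled element is determined by
    its label and the index of an antichain containing it, as a chain meets an antichain at most
    once; unlabelled elements already lie in these ranks. *)
Lemma lefschetz_k_sperner q : (1 <= q <= r)%N -> k_sperner P q.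
Proof.
case/andP=> q_gt0 le_q A antiA.
(* The window from [a] to [r - a] then has [q] or [q + 1] ranks, so its first [q] ranks include all
   those strictly inside it. *)
pose a := (r.+1 - q)./2.
have aE : ((r.+1 - q) = 2 * a)%N \/ ((r.+1 - q) = (2 * a).+1)%N.
  rewrite /a -{1 3}[(r.+1 - q)%N]odd_double_half -mul2n.
  by case: (odd _); [right | left].
have le_a : (2 * a <= r)%N by lia.
have [c [lab [c_lab labP labN]]] := chain_labeling le_a.
pose s := iota a q.
have size_s : size s = q by rewrite size_iota.
apply: (@leq_trans #|\bigcup_(i <- s) level P i|); last first.
  have uniq_r : uniq (iota 0 r.+1) by apply: iota_uniq.
  rewrite !card_bigcup_levels ?iota_uniq ?take_uniq ?sort_uniq //.
  rewrite /largest_ranks -size_s; apply: sum_le_take_sorted.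
  - by apply: sort_sorted => i j; apply: leq_total.
  - exact: iota_uniq.
  - by move=> i; rewrite mem_sort !mem_iota; lia.
have mem_s x : (x \in \bigcup_(i <- s) level P i) = (rk x \in s).
  elim: (s) => [|i s' IHs]; first by rewrite big_nil inE.
  by rewrite big_cons in_setU IHs !inE.
pose ix x := odflt (Ordinal q_gt0) [pick l : 'I_q | x \in A l].
have ixP x : x \in \bigcup_(l < q) A l -> x \in A (ix x).
  case/bigcupP=> l _ xA; rewrite /ix; case: pickP => //= /(_ l).
  by rewrite xA.
(* [f] moves a labelled element along its chain to the middle rank numbered by
   the antichain containing it. *)
pose f x := if lab x is Some i then c (ix x) i else x.
have le_ix x : (ix x <= r - 2 * a)%N by have := ltn_ord (ix x); lia.
have f_inj : {in \bigcup_(l < q) A l &, injective f}.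
  move=> x y /ixP xA /ixP yA; rewrite /f.
  case lab_x: (lab x) => [i|]; case lab_y: (lab y) => [l|] //.
  - have [rk_x lab_cx] := c_lab _ i (le_ix x).
    have [rk_y lab_cy] := c_lab _ l (le_ix y) => eq_c.
    have eq_il : i = l by apply: Some_inj; rewrite -lab_cx eq_c.
    have /val_inj eq_ix : ix x = ix y :> nat.
      by have := congr1 rk eq_c; rewrite rk_x rk_y => /addnI.
    rewrite -eq_il in lab_y; rewrite -eq_ix in yA.
    case: (leqP (rk x) (rk y)) => [le_xy|/ltnW le_yx].
      apply: (antiA (ix x)) => //; apply: labP lab_x lab_y => //.
      exact: rank_leq.
    apply/esym/(antiA (ix x)) => //; apply: labP lab_y lab_x => //.
    exact: rank_leq.
  (* A moved element lands on a labelled one, so it cannot meet a fixed unlabelled element. *)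
  - have [_ lab_c] := c_lab _ i (le_ix x).
    by move=> eq_c; rewrite eq_c lab_y in lab_c.
  - have [_ lab_c] := c_lab _ l (le_ix y).
    by move=> eq_c; rewrite -eq_c lab_x in lab_c.
rewrite -(card_in_imset f_inj).
apply/subset_leq_card/subsetP=> _ /imsetP[x _ ->].
rewrite mem_s mem_iota /f; case lab_x: (lab x) => [i|]; last first.
  by move/labN: lab_x; lia.
by have [-> _] := c_lab _ i (le_ix x); rewrite leq_addr ltn_add2l ltn_ord.
Qed.

(** The upward injections give growth up to the middle rank, and symmetry gives the descent. *)
Lemma lefschetz_unimodal : rank_unimodal P.
Proof.
have up k : (2 * k < r)%N -> (#|level P k| <= #|level P k.+1|)%N.
  move=> lt_k; have [phi [phi_inj phiP]] := up_injection lt_k.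
  rewrite -(card_in_imset phi_inj).
  apply/subset_leq_card/subsetP=> _ /imsetP[x xk ->].
  by rewrite inE; have [-> _] := phiP x xk.
have halfE := odd_double_half r.
exists r./2; first by lia.
split=> [i lt_i|i /andP[le_i lt_i]]; first by apply: up; lia.
rewrite sym // (sym (ltnW lt_i)).
have -> : (r - i = (r - i.+1).+1)%N by lia.
by apply: up; lia.
Qed.

Theorem lefschetz_peck : peck P.
Proof.
split; [exact: sym | exact: lefschetz_unimodal | exact: lefschetz_k_sperner].
Qed.

End Lefschetz.

Local Close Scope ring_scope.

Theorem theorem1p1 (n : nat) (n_ge1 : 1 <= n) :
  strongly_sperner (weak_order n) /\ peck (weak_order n).
Proof.
case: n n_ge1 => // k _.
suff pk : peck (weak_order k.+1) by split=> //; case: pk.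
apply: (lefschetz_peck (@wsum_raise_cover k) (@weak_rank_symmetric k)).
exact: weak_lefschetz.
Qed.
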